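(* Let $\theta>0$ and $V:\mathbb{Z}\to\mathbb{R}$. Let $\psi_n^{V;\theta}$ be the $n$-th step state of the quantum walk on $\mathbb{Z}$ with site-dependent coin $C=\sum_{x\in\mathbb{Z}}e_xe_x^*\otimes e^{iV(x)}e^{i\theta\sigma_1}$ and initial state $\psi_0\in\ell^2(\mathbb{Z})\otimes\ell^2(\{\pm1\})$. Then for every $n\ge1$, $x\in\mathbb{Z}$ and $z\in\{\pm1\}$, $$\psi_n^{V;\theta}(x,z)=e^{n\theta}\,\mathbb{E}\left[i^{S_n}e^{i[V(X_1)+\cdots+V(X_n)]}\psi_0(X_n,Z_n)\right],$$ where $(S_n,Z_n,X_n)$ is the process defined in the context, started from $(S_0,Z_0,X_0)=(0,z,x)$ and driven by independent $N_j\sim\mathrm{Poisson}(\theta)$, $j\ge1$.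
   Context: Quantum walk: on $\ell^2(\mathbb{Z}\times\{\pm1\})\cong\ell^2(\mathbb{Z})\otimes\ell^2(\{\pm1\})$ with orthonormal basis $e_xe_z$ and $\psi=\sum_{x,z}\psi(x,z)e_xe_z$, the walk operator is $W=SC$ with $C$ the coin operator and $Se_xe_z=e_{x+z}e_z$; $\psi_n=W\psi_{n-1}$ for $n\ge1$. In the ordered basis $(e_1,e_{-1})$, $e^{i\theta\sigma_1}=\begin{bmatrix}\cos\theta&i\sin\theta\\ i\sin\theta&\cos\theta\end{bmatrix}$. Process: $S_0=0$, $S_n=\sum_{j=1}^nN_j\pmod4\in\{0,1,2,3\}$; $Z_0=z$, $Z_n=(-1)^{S_n}z$; $X_0=x$, $X_n=x-\sum_{j=0}^{n-1}Z_j$ for $n\ge1$. *)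

(* Defs.v *)
From HB Require Import structures.
From mathcomp Require Import all_boot all_order all_algebra finmap.
From mathcomp Require Import all_classical all_reals all_analysis.
From mathcomp Require Export complex.
From mathcomp Require Import ring.

Set Implicit Arguments.
Unset Strict Implicit.
Unset Printing Implicit Defensive.

Import Order.TTheory GRing.Theory Num.Theory.
Import numFieldNormedType.Exports.

Local Open Scope classical_set_scope.
Local Open Scope ring_scope.
Local Open Scope complex_scope.

Definition pm1 : seq int := [:: 1; -1].
Notation spin := (seq_sub pm1).

Definition up : spin := SeqSub (mem_head 1 [:: -1] : 1 \in pm1).
Definition down : spin := SeqSub (mem_last 1 [:: -1] : -1 \in pm1).

Lemma spinP (z : spin) : z = up \/ z = down.
Proof.
have := ssvalP z; rewrite !inE => /orP[]/eqP e; [left|right]; exact: val_inj.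
Qed.

Lemma sum_spin (M : nmodType) (F : spin -> M) : \sum_z F z = F up + F down.
Proof.
rewrite (bigD1 up)//= (bigD1 down)//= big1 ?addr0// => z.
by case: (spinP z) => ->.
Qed.

Lemma sign_pm1 (k : nat) (z : spin) : (-1) ^+ k * val z \in pm1.
Proof. by rewrite -signr_odd; case: (spinP z) => ->; case: (odd k). Qed.

Definition sign_spin (k : nat) (z : spin) : spin := SeqSub (sign_pm1 k z).

Section walk.
Variable R : realType.
Implicit Types (V : int -> R) (theta t : R).

Definition state := int * spin -> R[i].
Implicit Types psi : state.

(* psi lies in l^2(Z x {+-1}) *)
Definition l2 psi : Prop :=
  summable setT (fun p => (ComplexField.Normc.normc (psi p) ^+ 2)%:E).

(* e_x e_z *)
Definition basis (x : int) (z : spin) : state := fun p => (p == (x, z))%:R.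

Definition expi t : R[i] := cos t +i* sin t.

(* the (z, z') entry of e^{i theta sigma_1} in the basis (e_1, e_{-1}) *)
Definition expi_sigma1 theta (z z' : spin) : R[i] :=
  if z == z' then (cos theta)%:C else 0 +i* sin theta.

(* the coin operator: it multiplies the fibre {x} x {+-1} by the matrix
   e^{i V(x)} e^{i theta sigma_1}; see coin_basis *)
Definition coin V theta psi : state := fun p =>
  expi (V p.1) * \sum_(z' : spin) expi_sigma1 theta p.2 z' * psi (p.1, z').

(* S e_x e_z = e_{x+z} e_z, written in coordinates; see shift_basis *)
Definition shift psi : state := fun p => psi (p.1 - val p.2, p.2).

Definition walk V theta psi : state := shift (coin V theta psi).

Definition walk_state V theta psi0 (n : nat) : state :=
  iter n (walk V theta) psi0.

(* shift and coin are linear, are l^2-isometries, and act on the orthonormal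
   basis as prescribed; this determines them as operators on l^2. *)

Lemma shift_linear (a : R[i]) psi phi :
  shift (fun p => a * psi p + phi p) = (fun p => a * shift psi p + shift phi p).
Proof. by []. Qed.

Lemma coin_linear V theta (a : R[i]) psi phi :
  coin V theta (fun p => a * psi p + phi p) =
  (fun p => a * coin V theta psi p + coin V theta phi p).
Proof. by apply/funext => p; rewrite /coin !sum_spin; ring. Qed.

Lemma shift_basis x z : shift (basis x z) = basis (x + val z) z.
Proof.
apply/funext => -[y w]; rewrite /shift /basis /= !xpair_eqE.
by case: (eqVneq w z) => [->|_]; rewrite ?andbF// !andbT subr_eq.
Qed.

Lemma coin_basis V theta x z : coin V theta (basis x z) =
  (fun p => expi (V x) *
    \sum_(w : spin) expi_sigma1 theta w z * basis x w p).
Proof.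
apply/funext => -[y w]; rewrite /coin /basis /= !sum_spin !xpair_eqE.
have [->|_] /= := eqVneq y x; last by rewrite !mulr0 addr0 !mulr0.
by case: (spinP w) => ->; case: (spinP z) => ->;
  rewrite /= ?mulr0n ?mulr1n !(mulr0, mulr1, add0r, addr0).
Qed.

Local Notation sqn c := (ComplexField.Normc.normc c ^+ 2).

Let sqnE (c : R[i]) : sqn c = complex.Re c ^+ 2 + complex.Im c ^+ 2.
Proof. by case: c => a b; rewrite /= sqr_sqrtr// addr_ge0// sqr_ge0. Qed.

Lemma shift_isometry psi :
  (\esum_(p in setT) (sqn (shift psi p))%:E =
   \esum_(p in setT) (sqn (psi p))%:E)%E.
Proof.
rewrite [RHS](@reindex_esum _ _ _ setT setT
  (fun p : int * spin => (p.1 - val p.2, p.2)))//.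
split => //.
- move=> [x z] [y w] _ _ /= /eqP; rewrite xpair_eqE => /andP[/eqP + /eqP zw].
  by rewrite zw => e; rewrite -[x](subrK (ssval w)) e subrK.
- by move=> [x z] _ /=; exists (x + val z, z) => //=; rewrite addrK.
Qed.

Lemma coin_isometry V theta psi :
  (\esum_(p in setT) (sqn (coin V theta psi p))%:E =
   \esum_(p in setT) (sqn (psi p))%:E)%E.
Proof.
have aux (f : state) : (\esum_(p in setT) (sqn (f p))%:E =
    \esum_(x in [set: int]) (sqn (f (x, up)) + sqn (f (x, down)))%:E)%E.
  transitivity (\esum_(x in [set: int]) \esum_(z in [set: spin])
      (sqn (f (x, z)))%:E)%E.
    rewrite esum_esum; last by move=> *; rewrite lee_fin sqr_ge0.
    rewrite (_ : setT `*`` _ = setT); last by apply/seteqP; split.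
    by apply: eq_esum => -[].
  apply: eq_esum => x _.
  rewrite esum_fset; last 2 first.
  - exact: finite_finset.
  - by move=> *; rewrite lee_fin sqr_ge0.
  rewrite (@fsbigE _ _ _ _ _ [:: up; down])//=; last first.
    by move=> i _; case: (spinP i) => ->.
  by rewrite !big_cons !big_nil /= !mem_setT adde0.
rewrite !aux; apply: eq_esum => x _; congr EFin.
rewrite !sqnE /coin /expi /expi_sigma1 /= !sum_spin /=.
case: (psi (x, up)) => a b; case: (psi (x, down)) => c d /=.
have := cos2Dsin2 theta; have := cos2Dsin2 (V x).
move: (cos _) (sin _) (cos _) (sin _) => C1 S1 C2 S2 e1 e2.
transitivity ((C1 ^+ 2 + S1 ^+ 2) * (C2 ^+ 2 + S2 ^+ 2) *
  (a ^+ 2 + b ^+ 2 + (c ^+ 2 + d ^+ 2))); first by ring.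
by rewrite e1 e2 !mul1r.
Qed.

Lemma walk_l2 V theta psi : l2 psi -> l2 (walk V theta psi).
Proof.
have abs (f : state) : (\esum_(p in setT) `|(sqn (f p))%:E| =
    \esum_(p in setT) (sqn (f p))%:E)%E.
  by apply: eq_esum => p _; rewrite gee0_abs// lee_fin sqr_ge0.
by rewrite /l2 /summable !abs shift_isometry coin_isometry.
Qed.

End walk.

Section process.
(* N is a sample path; N 0 is never used. *)
Variable N : nat -> nat.

Definition procS (n : nat) : nat := ((\sum_(1 <= j < n.+1) N j) %% 4)%N.

Definition procZ (z : spin) (n : nat) : spin := sign_spin (procS n) z.

Definition procX (x : int) (z : spin) (n : nat) : int :=
  x - \sum_(0 <= j < n) val (procZ z j).

End process.

Section probability.
Context d (T : measurableType d) (R : realType) (P : probability T R).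

Definition mutually_independent (I : choiceType) (D : set I)
    d' (T' : measurableType d') (X : I -> {RV P >-> T'}) : Prop :=
  forall (J : {fset I}) (A : I -> set T'),
    [set` J] `<=` D -> (forall j, j \in J -> measurable (A j)) ->
    P (\bigcap_(j in [set` J]) X j @^-1` A j) =
    (\prod_(j <- J) P (X j @^-1` A j))%E.

Definition poisson_distributed (X : {RV P >-> nat}) (theta : R) : Prop :=
  forall k, P (X @^-1` [set k]) = (poisson_pmf theta k)%:E.

Definition cintegrable (Y : T -> R[i]) : Prop :=
  P.-integrable setT (fun w => (complex.Re (Y w))%:E) /\
  P.-integrable setT (fun w => (complex.Im (Y w))%:E).

(* meaningful when cintegrable Y *)
Definition cexpectation (Y : T -> R[i]) : R[i] :=
  fine 'E_P[fun w => complex.Re (Y w)] +i* fine 'E_P[fun w => complex.Im (Y w)].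

End probability.

(* Main.v *)
Require Import Defs.
From mathcomp Require Import all_boot all_order all_algebra finmap.
From mathcomp Require Import all_classical all_reals all_analysis.
From mathcomp Require Import ring.

Set Implicit Arguments.
Unset Strict Implicit.
Unset Printing Implicit Defensive.

Import Order.TTheory GRing.Theory Num.Theory.
Import numFieldNormedType.Exports.

Local Open Scope ring_scope.
Local Open Scope complex_scope.

(** The random variable inside the expectation depends on N_1, ..., N_n only
through their residues mod 4, because i^4 = 1 and (-1)^4 = 1.  It is thus a
function of a random tuple with values in the finite set {0,1,2,3}^n, and its
expectation is a finite sum weighted by a product law; integrability is
automatic.

The coin matrix is itself a Poisson average.  If N has the Poisson law of
parameter theta, then e^theta P(N = r mod 4) is the sum of theta^k / k! over the
k congruent to r mod 4, so the exponential series of i theta sigma_1, grouped by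
powers of i sigma_1 (which has order 4), gives, for every g on the two spins,
  e^theta E[i^N g((-1)^N z)] = cos theta g(z) + i sin theta g(-z):
the entry at z of e^{i theta sigma_1} g.  This is [poisson_coin].

It remains to peel off the first step.  After it, the process is the same
process driven by N_2, N_3, ... and started from (x - z, (-1)^{N_1} z), and the
functional factors accordingly ([path_functional_recl]).  The walk satisfies the
same recursion: psi_{n+1}(x,z) is e^{iV(x-z)} times the coin average of
psi_n(x-z, .).  Induction on n gives [walk_average], a purely algebraic
statement in which any weights p on {0,1,2,3} satisfying the above identity may
replace the Poisson residues.  Independence identifies the joint law of the
residues with the product weights ([residues_law]). *)

(** * Phases and spins *)

Section phases.
Variable R : realType.
Implicit Types (a b : R) (k : nat).

Lemma expi0 : expi (0 : R) = 1.
Proof. by rewrite /expi cos0 sin0. Qed.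

Lemma expiD a b : expi (a + b) = expi a * expi b.
Proof.
rewrite /expi cosD sinD; apply/eqP; rewrite eq_complex /=.
by apply/andP; split; apply/eqP; ring.
Qed.

Lemma imiE a : 0 +i* a = (0 +i* 1) * a%:C.
Proof.
by apply/eqP; rewrite eq_complex /= !(mul0r, mulr0, mul1r) subr0 add0r !eqxx.
Qed.

Lemma imi_sqr : (0 +i* 1) ^+ 2 = -1 :> R[i].
Proof.
by rewrite expr2; apply/eqP; rewrite eq_complex /= !(mul0r, mulr0, mulr1) sub0r
  addr0 oppr0 !eqxx.
Qed.

Lemma imi_exp4 : (0 +i* 1) ^+ 4 = 1 :> R[i].
Proof. by rewrite (exprM _ 2 2) imi_sqr sqrrN expr1n. Qed.

Lemma imi_exp_mod4 k : (0 +i* 1) ^+ (k %% 4) = (0 +i* 1) ^+ k :> R[i].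
Proof. by rewrite [in RHS](divn_eq k 4) exprD mulnC exprM imi_exp4 expr1n mul1r. Qed.

End phases.

Lemma odd_mod4 k : odd (k %% 4) = odd k.
Proof. by rewrite [in RHS](divn_eq k 4) oddD oddM andbF. Qed.

Lemma sign_spin_mod4 k z : sign_spin (k %% 4) z = sign_spin k z.
Proof. by apply: val_inj; rewrite /= -signr_odd odd_mod4 signr_odd. Qed.

Lemma sign_spin_add k l z : sign_spin (k + l) z = sign_spin l (sign_spin k z).
Proof. by apply: val_inj; rewrite /= exprD mulrCA mulrA. Qed.

Lemma sign_spin_id z : sign_spin 0 z = z.
Proof. by apply: val_inj; rewrite /= mul1r. Qed.

Lemma sign_spin_odd k z : sign_spin k z = if odd k then sign_spin 1 z else z.
Proof.
by apply: val_inj; rewrite /= -signr_odd; case: odd; rewrite /= ?expr1 ?mul1r.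
Qed.

(** * The process seen after its first step *)

Section first_step.
Implicit Types (N : nat -> nat) (x : int) (z : spin) (n : nat).

Lemma procZ0 N z : procZ N z 0 = z.
Proof. by rewrite /procZ /procS big_geq// mod0n sign_spin_id. Qed.

Lemma procX0 N x z : procX N x z 0 = x.
Proof. by rewrite /procX big_geq// subr0. Qed.

Lemma procS_recl N n : procS N n.+1 = ((N 1%N + procS (N \o S) n) %% 4)%N.
Proof. by rewrite /procS big_nat_recl// big_add1 modnDmr. Qed.

Lemma procZ_recl N z n :
  procZ N z n.+1 = procZ (N \o S) (sign_spin (N 1%N) z) n.
Proof. by rewrite /procZ procS_recl sign_spin_mod4 sign_spin_add. Qed.

Lemma procX_recl N x z n :
  procX N x z n.+1 = procX (N \o S) (x - val z) (sign_spin (N 1%N) z) n.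
Proof.
rewrite /procX big_nat_recl// procZ0 opprD addrA; congr (_ - _).
by apply: eq_bigr => j _; rewrite procZ_recl.
Qed.

End first_step.

Section path_functional.
Variables (R : realType) (V : int -> R) (psi0 : state R).
Implicit Types (N : nat -> nat) (x : int) (z : spin) (n : nat).

Definition path_functional N n x z : R[i] :=
  (0 +i* 1) ^+ procS N n * expi (\sum_(1 <= k < n.+1) V (procX N x z k)) *
  psi0 (procX N x z n, procZ N z n).

Lemma path_functional0 N x z : path_functional N 0 x z = psi0 (x, z).
Proof.
by rewrite /path_functional procX0 procZ0 /procS !big_geq// mod0n expr0 expi0 !mul1r.
Qed.

(** The potential V(X_1) = V(x - z) does not depend on N, and i^{N_1} is the only
phase of the first step that does; this is what lets the average over N_1 act as
the coin at the site x - z. *)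
Lemma path_functional_recl N n x z :
  path_functional N n.+1 x z =
  (0 +i* 1) ^+ N 1%N * expi (V (x - val z)) *
  path_functional (N \o S) n (x - val z) (sign_spin (N 1%N) z).
Proof.
rewrite /path_functional big_nat_recl// big_add1 /= procX_recl procX0.
under eq_bigr do rewrite procX_recl.
rewrite procX_recl procZ_recl procS_recl imi_exp_mod4 exprD expiD.
rewrite [in RHS]big_add1 /=; move: (expi (\sum_(_ <= _ < _) _)) => e.
by rewrite !mulrA; congr (_ * _ * _); exact: mulrAC.
Qed.

Lemma eq_path_functional N N' n x z :
  (forall j, (1 <= j <= n)%N -> N j = N' j %[mod 4]) ->
  path_functional N n x z = path_functional N' n x z.
Proof.
elim: n N N' x z => [|n IH] N N' x z NN'; first by rewrite !path_functional0.
have e1 := NN' 1%N isT.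
rewrite !path_functional_recl -imi_exp_mod4 -sign_spin_mod4 e1.
rewrite imi_exp_mod4 sign_spin_mod4; congr (_ * _).
by apply: IH => j /andP[j1 jn]; apply: NN'.
Qed.

End path_functional.

(** * The walk as an average over residues *)

Section averaging.
Variables (R : realType) (V : int -> R) (psi0 : state R) (theta : R).
Variable p : 'I_4 -> R.

(** Entry i of the tuple is the increment of time i + 1.  The value at time 0, a
copy of entry 0, is arbitrary: the process starts reading its increments at
time 1. *)
Definition tuple_path n (t : n.-tuple 'I_4) (j : nat) : nat := nth ord0 t j.-1.

Lemma sum_tuple_recl (M : nmodType) (I : finType) n (F : n.+1.-tuple I -> M) :
  \sum_t F t = \sum_(r : I) \sum_(t : n.-tuple I) F [tuple of r :: t].
Proof.
rewrite pair_big (reindex (fun q : I * n.-tuple I => [tuple of q.1 :: q.2]))//=.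
exists (fun t : n.+1.-tuple I => (thead t, [tuple of behead t])).
- by move=> [r t] _ /=; congr pair; apply: val_inj.
- by move=> t _; rewrite /= [RHS]tuple_eta.
Qed.

Hypothesis p_coin : forall (z : spin) (g : spin -> R[i]),
  (expR theta)%:C *
    \sum_(r < 4) (p r)%:C * ((0 +i* 1) ^+ r * g (sign_spin r z)) =
  \sum_z' expi_sigma1 theta z z' * g z'.

Lemma walk_state_recl n x z :
  walk_state V theta psi0 n.+1 (x, z) =
  expi (V (x - val z)) *
  \sum_z' expi_sigma1 theta z z' * walk_state V theta psi0 n (x - val z, z').
Proof. by []. Qed.

(** Induction on the number of steps: summing over the first entry of the tuple
reproduces the coin by [p_coin], and the remaining entries give the walk after n
steps from each of the two spins at the site x - z. *)
Lemma walk_average n x z :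
  (expR (n%:R * theta))%:C *
    \sum_(t : n.-tuple 'I_4)
       path_functional V psi0 (tuple_path t) n x z *
       (\prod_(i < n) p (tnth t i))%:C =
  walk_state V theta psi0 n (x, z).
Proof.
elim: n x z => [|n IH] x z.
  rewrite mul0r expR0 mul1r (big_pred1 [tuple])/=; last first.
    by move=> t; apply/esym/eqP; exact: tuple0.
  by rewrite big_ord0 mulr1 path_functional0.
rewrite walk_state_recl sum_tuple_recl.
under [in RHS]eq_bigr => z' _ do rewrite -IH.
(* The function averaged by the coin is e^{n theta} times the n-step sum. *)
rewrite -(p_coin z (fun z' => (expR (n%:R * theta))%:C * _)).
rewrite -natr1 mulrDl mul1r expRD rmorphM /=.
rewrite !mulr_sumr; apply: eq_bigr => r _.
rewrite !mulr_sumr; apply: eq_bigr => t _.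
rewrite path_functional_recl big_ord_recl rmorphM /= tnth0.
rewrite (eq_path_functional V psi0 _ _ (N' := tuple_path t)); last first.
  (* The shifted path and the path of the tail differ at time 0 only. *)
  by move=> [|j].
under eq_bigr do rewrite tnthS.
rewrite /tuple_path /=.
by ring.
Qed.

End averaging.

(** * Expectation of a function of a finite-valued variable *)

Section finite_valued.
Local Open Scope classical_set_scope.
Local Open Scope ring_scope.
Context d (T : measurableType d) (R : realType) (P : probability T R).
Variables (K : finType) (m : T -> K).
Hypothesis m_meas : forall k, measurable (m @^-1` [set k]).

(** A finite-valued variable is a finite combination of indicators of its
fibres, which reduces integrals of functions of it to measures of fibres. *)
Let indic_decomp (f : K -> R) :
  (fun w => (f (m w))%:E) =
  (fun w => \sum_k (f k)%:E * (\1_(m @^-1` [set k]) w)%:E)%E.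
Proof.
apply/funext => w; rewrite (bigD1 (m w))//= big1 ?adde0.
  by rewrite indicE mem_set// mule1.
by move=> k km; rewrite indicE memNset ?mule0// => /esym/eqP; rewrite (negbTE km).
Qed.

Lemma integrable_finite_valued (f : K -> R) :
  P.-integrable setT (fun w => (f (m w))%:E).
Proof.
rewrite indic_decomp; apply: integrable_sum => // k _.
by apply: integrableZl => //; exact: integrable_indic.
Qed.

Lemma integral_finite_valued (f : K -> R) :
  fine (\int[P]_w (f (m w))%:E)%E =
  \sum_k f k * fine (P (m @^-1` [set k])).
Proof.
rewrite indic_decomp integral_sum//; last first.
  by move=> k; apply: integrableZl => //; exact: integrable_indic.
rewrite -sum_fine => [|k _]; last first.
  rewrite integralZl//; last exact: integrable_indic.
  by rewrite integral_indic// setIT fin_numM// fin_num_measure.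
apply: eq_bigr => k _.
rewrite integralZl//; last exact: integrable_indic.
by rewrite integral_indic// setIT fineM// fin_num_measure.
Qed.

Lemma cintegrable_finite_valued (F : K -> R[i]) : cintegrable P (F \o m).
Proof.
by split; [exact: (integrable_finite_valued (fun k => complex.Re (F k)))
          |exact: (integrable_finite_valued (fun k => complex.Im (F k)))].
Qed.

Lemma cexpectation_finite_valued (F : K -> R[i]) :
  cexpectation P (F \o m) = \sum_k F k * (fine (P (m @^-1` [set k])))%:C.
Proof.
rewrite /cexpectation unlock.
rewrite (integral_finite_valued (fun k => complex.Re (F k))).
rewrite (integral_finite_valued (fun k => complex.Im (F k))).
apply/eqP; rewrite eq_complex !raddf_sum /=; apply/andP; split; apply/eqP;
  apply: eq_bigr => k _; case: (F k) => a b /=;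
  by rewrite !mulr0 ?subr0 ?add0r.
Qed.

End finite_valued.

(** * The coin as a Poisson average *)

Section poisson_mod4.
Local Open Scope classical_set_scope.
Local Open Scope ring_scope.
Context d (T : measurableType d) (R : realType) (P : probability T R).
Variable theta : R.
Hypothesis theta_gt0 : 0 < theta.

Definition residue_class (r : nat) : set nat := [set k | (k %% 4)%N = r].

(** The part of the exponential series supported on the residue class r. *)
Definition exp_coeff_mod4 (r : nat) : R^nat :=
  fun k => (k %% 4 == r)%N%:R * (theta ^+ k / k`!%:R).

(** Sigma-additivity over the values of X turns the probability of a residue
class into a subseries of the exponential series, the normalisation e^{-theta}
of the Poisson law being cancelled by e^theta. *)
Lemma poisson_residue_cvg (X : {RV P >-> nat}) (r : nat) :
  poisson_distributed X theta ->
  (series (exp_coeff_mod4 r) @ \oo -->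
   expR theta * fine (P (X @^-1` residue_class r))).
Proof.
move=> X_poisson.
pose F k : set T :=
  if (k %% 4 == r)%N then (X @^-1` [set k]) else set0.
have mF k : measurable (F k).
  by rewrite /F; case: ifP => // _; exact: measurable_funPTI.
have tF : trivIset setT F.
  move=> i j _ _ [w []]; rewrite /F.
  by case: ifP => // _ <-; case: ifP => // _ <-.
have UF : (\bigcup_k F k = X @^-1` residue_class r).
  apply/seteqP; split => [w [k _]|w wr].
    by rewrite /F; case: ifP => // /eqP kr /= ->.
  by exists (X w) => //; rewrite /F wr eqxx.
have /fine_cvgP[_] : ((fun n => \sum_(0 <= k < n) P (F k))%E @ \oo -->
    (fine (P (X @^-1` residue_class r)))%:E).
  rewrite fineK ?fin_num_measure//; last exact: measurable_funPTI.
  rewrite -UF; apply: measure_semi_sigma_additive => //.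
  by rewrite UF; exact: measurable_funPTI.
move=> /(cvgM (cvg_cst (expR theta))); apply: cvg_trans; apply: near_eq_cvg.
apply: nearW => n /=; rewrite /series /=.
have PF k : P (F k) = (expR (- theta) * exp_coeff_mod4 r k)%:E.
  rewrite /F /exp_coeff_mod4; case: ifP => _; last first.
    by rewrite measure0 mul0r mulr0.
  by rewrite X_poisson /poisson_pmf theta_gt0 mul1r mulrC.
under eq_bigr do rewrite PF.
by rewrite sumEFin /= -mulr_sumr mulrA expRxMexpNx_1 mul1r.
Qed.

Lemma poisson_residue_unique (X X' : {RV P >-> nat}) (r : nat) :
  poisson_distributed X theta -> poisson_distributed X' theta ->
  fine (P (X @^-1` residue_class r)) = fine (P (X' @^-1` residue_class r)).
Proof.
move=> Xp X'p; apply: (mulfI (lt0r_neq0 (expR_gt0 theta))).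
have /cvg_lim <- // := poisson_residue_cvg (r := r) Xp.
by have /cvg_lim <- // := poisson_residue_cvg (r := r) X'p.
Qed.

(** The signs of the cosine series depend on the exponent mod 4: + at 0, - at 2,
and no term at odd exponents. *)
Lemma cos_coeff_mod4 :
  cos_coeff theta = exp_coeff_mod4 0 - exp_coeff_mod4 2.
Proof.
apply/funext => k.
transitivity (exp_coeff_mod4 0 k - exp_coeff_mod4 2 k); last by [].
rewrite /cos_coeff /exp_coeff_mod4 /= -mulrA -mulrBl.
congr (_ * _); rewrite -exprnP -signr_odd [in LHS](divn_eq k 4).
have : (k %% 4 < 4)%N by rewrite ltn_mod.
rewrite oddD oddM andbF addFb.
rewrite (_ : _ * 4 = ((k %/ 4).*2).*2)%N; last by rewrite -!muln2 -mulnA.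
rewrite halfD odd_double add0n doubleK oddD odd_double.
by case: (k %% 4)%N => [|[|[|[|]]]]//= _; ring.
Qed.

Lemma sin_coeff_mod4 :
  sin_coeff theta = exp_coeff_mod4 1 - exp_coeff_mod4 3.
Proof.
apply/funext => k.
transitivity (exp_coeff_mod4 1 k - exp_coeff_mod4 3 k); last by [].
rewrite /sin_coeff /exp_coeff_mod4 /= -mulrA -mulrBl.
congr (_ * _); rewrite -signr_odd [in LHS](divn_eq k 4).
have : (k %% 4 < 4)%N by rewrite ltn_mod.
rewrite oddD oddM andbF addFb.
rewrite (_ : _ * 4 = ((k %/ 4).*2).*2)%N; last by rewrite -!muln2 -mulnA.
case: (k %% 4)%N => [|[|[|[|]]]]//= _; rewrite ?addn1 ?addnS ?addn0 /=.
all: by rewrite ?uphalf_double ?doubleK /= ?odd_double/= ?mul0r; ring.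
Qed.

Lemma poisson_residue_cos (X : {RV P >-> nat}) :
  poisson_distributed X theta ->
  expR theta * (fine (P (X @^-1` residue_class 0)) -
                fine (P (X @^-1` residue_class 2))) = cos theta.
Proof.
move=> Xp; rewrite mulrBr unlock cos_coeff_mod4; apply/esym/cvg_lim => //.
rewrite seriesD seriesN.
by apply: cvgB; exact: poisson_residue_cvg.
Qed.

Lemma poisson_residue_sin (X : {RV P >-> nat}) :
  poisson_distributed X theta ->
  expR theta * (fine (P (X @^-1` residue_class 1)) -
                fine (P (X @^-1` residue_class 3))) = sin theta.
Proof.
move=> Xp; rewrite mulrBr unlock sin_coeff_mod4; apply/esym/cvg_lim => //.
rewrite seriesD seriesN.
by apply: cvgB; exact: poisson_residue_cvg.
Qed.

(** The weight i^r takes the values 1, i, -1, -i and the spin flips exactly for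
odd r, so the classes 0 and 2 combine into cos theta on the unflipped spin and
the classes 1 and 3 into i sin theta on the flipped one. *)
Lemma poisson_coin (X : {RV P >-> nat}) (z : spin) (g : spin -> R[i]) :
  poisson_distributed X theta ->
  (expR theta)%:C *
    \sum_(r < 4) (fine (P (X @^-1` residue_class r)))%:C *
                 ((0 +i* 1) ^+ r * g (sign_spin r z)) =
  \sum_z' expi_sigma1 theta z z' * g z'.
Proof.
move=> Xp.
transitivity ((cos theta)%:C * g z + (0 +i* sin theta) * g (sign_spin 1 z)).
  rewrite [0 +i* sin theta]imiE -(poisson_residue_cos Xp) -(poisson_residue_sin Xp).
  rewrite !big_ord_recl big_ord0 /= /bump /= !add1n.
  rewrite !(sign_spin_odd 2) !(sign_spin_odd 3) sign_spin_id /=.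
  rewrite (_ : (0 +i* 1) ^+ 3 = - (0 +i* 1)); last first.
    by rewrite exprS imi_sqr mulrN1.
  rewrite imi_sqr expr0 expr1.
  rewrite !rmorphM !rmorphB /=.
  by ring.
rewrite sum_spin /expi_sigma1.
have up1 : sign_spin 1 Defs.up = Defs.down by exact: val_inj.
have down1 : sign_spin 1 Defs.down = Defs.up by exact: val_inj.
by case: (spinP z) => ->; rewrite ?up1 ?down1 //= addrC.
Qed.

End poisson_mod4.

(** * Joint law of the residues *)

Section joint_law.
Local Open Scope classical_set_scope.
Local Open Scope ring_scope.
Context d (T : measurableType d) (R : realType) (P : probability T R).
Variable N : nat -> {RV P >-> nat}.

Definition residues n (w : T) : n.-tuple 'I_4 :=
  [tuple inord (N i.+1 w %% 4) | i < n].

Lemma tuple_path_residues n w j :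
  (j < n)%N -> tuple_path (residues n w) j.+1 = (N j.+1 w %% 4)%N.
Proof.
move=> jn; rewrite /tuple_path /=.
have <- : tnth (residues n w) (Ordinal jn) = nth ord0 (residues n w) j.
  exact: tnth_nth.
by rewrite tnth_mktuple inordK// ltn_mod.
Qed.

(** The joint event written as an intersection over the finite set of times
1, ..., n, the form to which mutual independence applies. *)
Lemma residues_preimage n (t : n.-tuple 'I_4) :
  (residues n @^-1` [set t] =
   \bigcap_(j in [set` [fset i.+1 | i in iota 0 n]%fset])
     N j @^-1` residue_class (tuple_path t j)).
Proof.
apply/seteqP; split => [w <- j|w wt].
  rewrite /= => /imfsetP[i /=]; rewrite mem_iota add0n => /= lt_in ->.
  by rewrite tuple_path_residues.
apply: eq_from_tnth => i; rewrite tnth_mktuple.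
have /wt : i.+1 \in [fset i.+1 | i in iota 0 n]%fset.
  by apply/imfsetP; exists (val i) => //=; rewrite mem_iota add0n/=.
rewrite /residue_class /tuple_path /= => ->.
by rewrite -tnth_nth inord_val.
Qed.

Lemma measurable_residues n (t : n.-tuple 'I_4) :
  measurable (residues n @^-1` [set t]).
Proof.
rewrite residues_preimage; apply: bigcap_measurableType => // j _.
exact: measurable_funPTI.
Qed.

Lemma residues_law n (t : n.-tuple 'I_4) (p : 'I_4 -> R) :
  mutually_independent [set j | (1 <= j)%N] N ->
  (forall j (r : 'I_4), (1 <= j)%N ->
     fine (P (N j @^-1` residue_class r)) = p r) ->
  fine (P (residues n @^-1` [set t])) = \prod_(i < n) p (tnth t i).
Proof.
move=> N_indep Np; rewrite residues_preimage N_indep//; last first.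
  by move=> j /= /imfsetP[i _ ->].
rewrite big_imfset/=; last by move=> i j _ _ [].
rewrite undup_id ?iota_uniq// -val_enum_ord big_map enumT.
have finP i : P (N i @^-1` residue_class (tuple_path t i)) \is a fin_num.
  by apply: fin_num_measure; exact: measurable_funPTI.
rewrite (eq_bigr (fun i : 'I_n => (p (tnth t i))%:E)) ?prodEFin// => i _.
by rewrite -(Np i.+1 _ isT) (tnth_nth ord0) fineK.
Qed.

End joint_law.

Theorem theorem5p6 (R : realType) (theta : R) (theta_gt0 : 0 < theta)
    (V : int -> R) (psi0 : state R) (psi0_l2 : l2 psi0)
    (d : measure_display) (T : measurableType d) (P : probability T R)
    (N : nat -> {RV P >-> nat})
    (N_indep : mutually_independent [set j | (1 <= j)%N]%classic N)
    (N_poisson : forall j, (1 <= j)%N -> poisson_distributed (N j) theta)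
    (n : nat) (n_ge1 : (1 <= n)%N) (x : int) (z : spin) :
  let S k w := procS (N ^~ w) k in
  let Z k w := procZ (N ^~ w) z k in
  let X k w := procX (N ^~ w) x z k in
  let Y w := (0 +i* 1) ^+ S n w * expi (\sum_(1 <= k < n.+1) V (X k w)) *
             psi0 (X n w, Z n w) in
  cintegrable P Y /\
  walk_state V theta psi0 n (x, z) =
    (expR (n%:R * theta))%:C * cexpectation P Y.
Proof.
move=> S Z X Y.
pose F (t : n.-tuple 'I_4) := path_functional V psi0 (tuple_path t) n x z.
have -> : Y = F \o residues N n.
  apply/funext => w; apply: eq_path_functional => -[|j] //= jn.
  by rewrite tuple_path_residues ?modn_mod.
have mN := @measurable_residues _ _ _ _ N n.
split; first exact: cintegrable_finite_valued.
rewrite cexpectation_finite_valued//.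
pose p (r : 'I_4) := fine (P (N 1%N @^-1` residue_class r)%classic).
rewrite -(@walk_average _ V psi0 theta p); last first.
  by move=> z' g; apply: poisson_coin => //; exact: N_poisson.
congr (_ * _); apply: eq_bigr => t _; congr (_ * _%:C).
apply/esym/residues_law => // j r j1.
by apply: (poisson_residue_unique theta_gt0); exact: N_poisson.
Qed.
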